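(* Let $F$ be a field, $\Lambda=M_s(F)$, and $A,B,C,D\in\Lambda$. Then, viewing $G(w^* )\in\Lambda[[z]]$ as an $s\times s$ matrix with entries in $F[[z]]$, all of its matrix entries are algebraic over $F(z)$.
   Context: A walk of length $l\ge0$ is an $(l+1)$-tuple $\alpha=(\alpha_0,\dots,\alpha_l)$ of integers with each $\alpha_i-\alpha_{i-1}\in\{-1,0,1\}$; it is a walk from $\alpha_0$ to $\alpha_l$. Define $w^*(\alpha)=1$ if $l=0$, and otherwise $w^*(\alpha)=U_1\cdots U_l$ where $U_i=A$ if $\alpha_i-\alpha_{i-1}=-1$, $U_i=C$ if $\alpha_i-\alpha_{i-1}=1$, and if $\alpha_i=\alpha_{i-1}$ then $U_i=D$ when $\alpha_i=\alpha_{i-1}=0$ and $U_i=B$ otherwise. A walk is standard if $\alpha_i\ge\alpha_l$ for all $i$. $G(w^* )=\sum w^*(\alpha)z^{l(\alpha)}$, the sum over all standard walks from $0$ to $0$. *)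

(* Defs.v *)
From HB Require Import structures.
From mathcomp Require Import all_boot all_order all_algebra.
From mathcomp Require Import generic_quotient.
From mathcomp Require Import boolp classical_sets functions cardinality fsbigop.

Set Implicit Arguments.
Unset Strict Implicit.
Unset Printing Implicit Defensive.

Import Order.TTheory GRing.Theory Num.Theory.
Local Open Scope ring_scope.

(** * Formal power series

[{fps R}] is R[[z]]; [coefs f n] is the coefficient of z^n.  The coefficient
ring may be noncommutative.  It is a record rather than [nat -> R], because the
latter already carries the pointwise product. *)

Record fps (R : Type) := Fps { coefs : nat -> R }.

Notation "{ 'fps' R }" := (fps R) (at level 0, format "{ 'fps'  R }").

Lemma fpsP (R : Type) (f g : {fps R}) : coefs f =1 coefs g <-> f = g.
Proof.
split=> [|-> //]; case: f g => [f] [g] /= fg; congr Fps; exact/funext.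
Qed.

HB.instance Definition _ (R : Type) := gen_eqMixin {fps R}.
HB.instance Definition _ (R : Type) := gen_choiceMixin {fps R}.

Section FpsZmodule.
Variable V : zmodType.
Implicit Types f g h : {fps V}.

Definition fps_zero : {fps V} := Fps (fun=> 0).
Definition fps_opp f : {fps V} := Fps (fun n => - coefs f n).
Definition fps_add f g : {fps V} := Fps (fun n => coefs f n + coefs g n).

Fact fps_addA : associative fps_add.
Proof. by move=> f g h; apply/fpsP => n /=; rewrite addrA. Qed.

Fact fps_addC : commutative fps_add.
Proof. by move=> f g; apply/fpsP => n /=; rewrite addrC. Qed.

Fact fps_add0 : left_id fps_zero fps_add.
Proof. by move=> f; apply/fpsP => n /=; rewrite add0r. Qed.

Fact fps_addN : left_inverse fps_zero fps_opp fps_add.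
Proof. by move=> f; apply/fpsP => n /=; rewrite addNr. Qed.

HB.instance Definition _ :=
  GRing.isZmodule.Build {fps V} fps_addA fps_addC fps_add0 fps_addN.

Lemma coefs0 n : coefs (0 : {fps V}) n = 0. Proof. by []. Qed.

Lemma coefsN f n : coefs (- f) n = - coefs f n. Proof. by []. Qed.

Lemma coefsD f g n : coefs (f + g) n = coefs f n + coefs g n.
Proof. by []. Qed.

Lemma coefsB f g n : coefs (f - g) n = coefs f n - coefs g n.
Proof. by []. Qed.

End FpsZmodule.

Section FpsRing.
Variable R : pzRingType.
Implicit Types f g h : {fps R}.

Definition fps_one : {fps R} := Fps (fun n => (n == 0)%:R).
Definition fps_mul f g : {fps R} :=
  Fps (fun n => \sum_(i < n.+1) coefs f i * coefs g (n - i)).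

Fact fps_mulE f g n :
  coefs (fps_mul f g) n = \sum_(i < n.+1) coefs f i * coefs g (n - i).
Proof. by []. Qed.

Fact fps_mul_rev f g n :
  coefs (fps_mul f g) n = \sum_(i < n.+1) coefs f (n - i) * coefs g i.
Proof.
rewrite /= (reindex_inj rev_ord_inj) /=.
by apply: eq_bigr => i _; rewrite subSS (sub_ordK i).
Qed.

Fact fps_mulA : associative fps_mul.
Proof.
move=> f g h; apply/fpsP => n; rewrite [RHS]fps_mul_rev [LHS]fps_mulE.
pose c3 j k := coefs f j * (coefs g (n - j - k) * coefs h k).
transitivity (\sum_(j < n.+1) \sum_(k < n.+1 | (k <= n - j)%N) c3 j k).
  apply: eq_bigr => j _; rewrite fps_mul_rev.
  by rewrite big_distrr /= (big_ord_narrow_leq (leq_subr _ _)).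
rewrite (exchange_big_dep predT) //; apply: eq_bigr => k _.
transitivity (\sum_(j < n.+1 | (j <= n - k)%N) c3 j k).
  apply: eq_bigl => j; rewrite -ltnS -(ltnS j) -!subSn ?leq_ord //.
  by rewrite -subn_gt0 -(subn_gt0 j) -!subnDA addnC.
rewrite (big_ord_narrow_leq (leq_subr _ _)) fps_mulE big_distrl /=.
by apply: eq_bigr => j _; rewrite /c3 -!subnDA addnC mulrA.
Qed.

Fact fps_mul1l : left_id fps_one fps_mul.
Proof.
move=> f; apply/fpsP => n; rewrite /= big_ord_recl subn0 mul1r.
by rewrite big1 ?addr0 // => j _; rewrite mul0r.
Qed.

Fact fps_mul1r : right_id fps_one fps_mul.
Proof.
move=> f; apply/fpsP => n; rewrite fps_mul_rev big_ord_recl subn0 mulr1.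
by rewrite big1 ?addr0 // => j _; rewrite mulr0.
Qed.

Fact fps_mulDl : left_distributive fps_mul +%R.
Proof.
move=> f g h; apply/fpsP => n; rewrite coefsD /= -big_split /=.
by apply: eq_bigr => i _; rewrite mulrDl.
Qed.

Fact fps_mulDr : right_distributive fps_mul +%R.
Proof.
move=> f g h; apply/fpsP => n; rewrite coefsD /= -big_split /=.
by apply: eq_bigr => i _; rewrite mulrDr.
Qed.

HB.instance Definition _ := GRing.Zmodule_isPzRing.Build {fps R}
  fps_mulA fps_mul1l fps_mul1r fps_mulDl fps_mulDr.

Lemma coefs1 n : coefs (1 : {fps R}) n = (n == 0)%:R. Proof. by []. Qed.

Lemma coefsM f g n :
  coefs (f * g) n = \sum_(i < n.+1) coefs f i * coefs g (n - i).
Proof. by []. Qed.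

End FpsRing.

Fact fps_one_neq0 (R : nzRingType) : (1 : {fps R}) != 0.
Proof.
by apply/eqP => /fpsP /(_ 0%N) /eqP; rewrite coefs0 coefs1 oner_eq0.
Qed.

HB.instance Definition _ (R : nzRingType) :=
  GRing.PzSemiRing_isNonZero.Build {fps R} (@fps_one_neq0 R).

Fact fps_mulC (R : comPzRingType) : commutative (@GRing.mul {fps R}).
Proof.
move=> f g; apply/fpsP => n; rewrite [LHS]fps_mul_rev coefsM.
by apply: eq_bigr => i _; rewrite mulrC.
Qed.

HB.instance Definition _ (R : comPzRingType) :=
  GRing.PzRing_hasCommutativeMul.Build {fps R} (@fps_mulC R).
HB.instance Definition _ (R : comNzRingType) := GRing.ComPzRing.on {fps R}.

Section FpsUnit.
Variable R : comNzRingType.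
Implicit Types f g : {fps R}.

Definition fps_unit : {pred {fps R}} := fun f => `[< exists g, g * f = 1 >].
Definition fps_inv f : {fps R} :=
  if pselect (exists g, g * f = 1) is left e then projT1 (cid e) else f.

Fact fps_mulV : {in fps_unit, left_inverse 1 fps_inv *%R}.
Proof.
move=> f /asboolP uf; rewrite /fps_inv.
by case: pselect => // e; exact: projT2 (cid e).
Qed.

Fact fps_unitPl f g : g * f = 1 -> fps_unit f.
Proof. by move=> gf; apply/asboolP; exists g. Qed.

Fact fps_inv_out : {in [predC fps_unit], fps_inv =1 id}.
Proof.
move=> f /negP nuf; rewrite /fps_inv.
by case: pselect => // e; case: nuf; exact/asboolP.
Qed.

HB.instance Definition _ := GRing.ComNzRing_hasMulInverse.Build {fps R}
  fps_mulV fps_unitPl fps_inv_out.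

End FpsUnit.

Fact fps_integral (R : idomainType) (f g : {fps R}) :
  f * g = 0 -> (f == 0) || (g == 0).
Proof.
move=> fg0; apply/norP => -[f0 g0].
have low (h : {fps R}) : h != 0 ->
    exists2 m, coefs h m != 0 & forall k, (k < m)%N -> coefs h k = 0.
  move=> h0; have exh : exists m, coefs h m != 0.
    apply: contrapT => nex; move/eqP: h0; apply; apply/fpsP => m.
    by apply/eqP; apply/negPn/negP => hm; apply: nex; exists m.
  case: (ex_minnP exh) => m hm mmin; exists m => // k km.
  by apply/eqP; apply: contraTT km => /mmin; rewrite -leqNgt.
have [m fm fmin] := low _ f0; have [n gn gmin] := low _ g0.
have := coefsM f g (m + n); rewrite fg0 coefs0.
have mlt : (m < (m + n).+1)%N by rewrite ltnS leq_addr.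
rewrite (bigD1 (Ordinal mlt)) //= addKn big1 ?addr0.
  by move/esym/eqP; rewrite mulf_eq0 (negPf fm) (negPf gn).
move=> i; rewrite -val_eqE /= => im.
have [lt_im|le_mi] := ltnP i m; first by rewrite fmin ?mul0r.
have lt_mi : (m < i)%N by rewrite ltn_neqAle eq_sym im.
have le_i : (i <= m + n)%N by rewrite -ltnS.
by rewrite gmin ?mulr0 // ltn_subLR // ltn_add2r.
Qed.

HB.instance Definition _ (R : idomainType) :=
  GRing.ComUnitRing_isIntegral.Build {fps R} (@fps_integral R).

(** * Rational functions as Laurent series

F(z) is [{fraction {poly F}}] and F((z)) is [{fraction {fps F}}]. *)

Section PolyFps.
Variable R : nzRingType.

Definition poly_fps (p : {poly R}) : {fps R} := Fps (fun n => p`_n).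

Fact poly_fps_is_zmod_morphism : zmod_morphism poly_fps.
Proof. by move=> p q; apply/fpsP => n; rewrite coefsB /= coefB. Qed.

HB.instance Definition _ :=
  GRing.isZmodMorphism.Build {poly R} {fps R} poly_fps
    poly_fps_is_zmod_morphism.

Fact poly_fps_is_monoid_morphism : monoid_morphism poly_fps.
Proof.
split=> [|p q]; apply/fpsP => n; first by rewrite coefs1 /= coef1.
by rewrite coefsM /= coefM.
Qed.

HB.instance Definition _ :=
  GRing.isMonoidMorphism.Build {poly R} {fps R} poly_fps
    poly_fps_is_monoid_morphism.

Lemma poly_fps_inj : injective poly_fps.
Proof. by move=> p q /fpsP pq; apply/polyP. Qed.

End PolyFps.

Section RatfunLaurent.
Variable F : fieldType.
Local Notation "x %:F" := (FracField.tofrac x).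

Definition ratfun_laurent (x : {fraction {poly F}}) : {fraction {fps F}} :=
  (poly_fps \n_(repr x))%:F / (poly_fps \d_(repr x))%:F.

Lemma poly_fps_tofrac_eq0 (p : {poly F}) : ((poly_fps p)%:F == 0) = (p == 0).
Proof. by rewrite tofrac_eq0 -(inj_eq (@poly_fps_inj F)) rmorph0. Qed.

Lemma fraction_repr (x : {fraction {poly F}}) :
  x = (\n_(repr x))%:F / (\d_(repr x))%:F.
Proof.
apply: (canRL (mulfK _)); first by rewrite tofrac_eq0 denom_ratioP.
rewrite -[X in X * _]reprK; unlock FracField.tofrac.
rewrite -[LHS]FracField.pi_mul; apply/eqP.
rewrite FracField.equivf_def /FracField.mulf.
by rewrite !numden_Ratio ?mulf_neq0 ?oner_eq0 ?denom_ratioP // !mulr1 mulrC.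
Qed.

Lemma ratfun_laurent_div (p q : {poly F}) : q != 0 ->
  ratfun_laurent (p%:F / q%:F) = (poly_fps p)%:F / (poly_fps q)%:F.
Proof.
move=> q0; rewrite /ratfun_laurent; set x := p%:F / q%:F.
have d0 : \d_(repr x) != 0 by rewrite denom_ratioP.
have := fraction_repr x; rewrite {1}/x => /eqP.
rewrite eqr_div ?tofrac_eq0 // -!tofracM tofrac_eq => /eqP pq.
apply/eqP; rewrite eqr_div ?poly_fps_tofrac_eq0 //.
by rewrite -!tofracM tofrac_eq -!rmorphM /= pq.
Qed.

Lemma ratfun_laurent_tofrac (p : {poly F}) :
  ratfun_laurent p%:F = (poly_fps p)%:F.
Proof.
rewrite -[p%:F]divr1 -tofrac1 ratfun_laurent_div ?oner_neq0 //.
by rewrite !rmorph1 divr1.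
Qed.

Lemma fractionP (x : {fraction {poly F}}) :
  exists p q : {poly F}, q != 0 /\ x = p%:F / q%:F.
Proof.
exists \n_(repr x), \d_(repr x).
by split; [rewrite denom_ratioP | exact: fraction_repr].
Qed.

Fact ratfun_laurent_is_zmod_morphism : zmod_morphism ratfun_laurent.
Proof.
move=> x y; have [a [b [b0 ->]]] := fractionP x.
have [c [d [d0 ->]]] := fractionP y.
have -> : a%:F / b%:F - c%:F / d%:F = (a * d - c * b)%:F / (b * d)%:F.
  rewrite -[- (c%:F / _)]mulNr addf_div ?tofrac_eq0 // mulNr.
  by rewrite -!tofracM tofracB.
rewrite !ratfun_laurent_div ?mulf_neq0 //.
rewrite -[- (_ / (poly_fps d)%:F)]mulNr addf_div ?poly_fps_tofrac_eq0 // mulNr.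
by rewrite !(rmorphB, rmorphM).
Qed.

HB.instance Definition _ :=
  GRing.isZmodMorphism.Build {fraction {poly F}} {fraction {fps F}}
    ratfun_laurent ratfun_laurent_is_zmod_morphism.

Fact ratfun_laurent_is_monoid_morphism : monoid_morphism ratfun_laurent.
Proof.
split=> [|x y].
  by rewrite -tofrac1 ratfun_laurent_tofrac !rmorph1.
have [a [b [b0 ->]]] := fractionP x; have [c [d [d0 ->]]] := fractionP y.
rewrite mulf_div -!tofracM !ratfun_laurent_div ?mulf_neq0 //.
by rewrite mulf_div !rmorphM.
Qed.

HB.instance Definition _ :=
  GRing.isMonoidMorphism.Build {fraction {poly F}} {fraction {fps F}}
    ratfun_laurent ratfun_laurent_is_monoid_morphism.

Definition algebraic_over_ratfun (f : {fps F}) : Prop :=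
  algebraicOver ratfun_laurent f%:F.

End RatfunLaurent.

(** The identification of M_s(R)[[z]] with M_s(R[[z]]). *)
Definition fps_mx (R : Type) (s : nat) (f : {fps 'M[R]_s}) : 'M[{fps R}]_s :=
  \matrix_(i, j) Fps (fun n => coefs f n i j).

(** * Walks

A walk of length [l] is a tuple [a] of [l.+1] integers; [a`_i] is its i-th
entry. *)

Definition is_walk (l : nat) (a : l.+1.-tuple int) : bool :=
  [forall i : 'I_l, a`_i.+1 - a`_i \in [:: -1; 0; 1]].

Definition is_standard (l : nat) (a : l.+1.-tuple int) : bool :=
  [forall i : 'I_l.+1, a`_l <= a`_i].

Definition standard_walks (l : nat) (x y : int) : set (l.+1.-tuple int) :=
  [set a | [/\ is_walk a, is_standard a, a`_0 = x & a`_l = y]]%classic.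

(* Ensures that a sum over [standard_walks] is a genuine one: [\sum_(_ \in _)]
   would be 0 over an infinite support. *)
Lemma finite_standard_walks (l : nat) (x y : int) :
  finite_set (@standard_walks l x y).
Proof.
pose f (c : {ffun 'I_l.+1 -> 'I_(l + l).+1}) : l.+1.-tuple int :=
  [tuple x + (c i)%:Z - l%:Z | i < l.+1].
apply: (@sub_finite_set _ _ (f @` setT)%classic); last first.
  exact/finite_image/finite_finset.
move=> a [/forallP wa _ a0 _].
have dist i : (i <= l)%N -> `|a`_i - x| <= i%:Z.
  elim: i => [|i IH] il; first by rewrite a0 subrr normr0.
  have -> : a`_i.+1 - x = (a`_i.+1 - a`_i) + (a`_i - x) by rewrite addrA subrK.
  apply: le_trans (ler_normD _ _) _; rewrite [leRHS]intS lerD //; last first.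
    exact/IH/ltnW.
  by have := wa (Ordinal il); rewrite !inE /= => /or3P[] /eqP ->.
exists [ffun i : 'I_l.+1 => inord `|(a`_i - x + l%:Z)%R|%N] => //.
apply/eq_from_tnth => i; rewrite tnth_mktuple ffunE.
have il : (i <= l)%N by rewrite -ltnS.
have := dist i il; rewrite ler_norml => /andP[lo hi].
have pos : 0 <= a`_i - x + l%:Z.
  by rewrite -lerBlDr sub0r; apply: le_trans lo; rewrite lerN2 lez_nat.
rewrite inordK; last first.
  rewrite ltnS -lez_nat gez0_abs // PoszD lerD2r.
  by apply: le_trans hi _; rewrite lez_nat.
by rewrite gez0_abs // (tnth_nth 0) /= addrA addrK addrC subrK.
Qed.

Section Weight.
Variables (L : pzRingType) (A B C D : L).

(* On a walk, the last two branches are reached only when [y = x]. *)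
Definition step_weight (x y : int) : L :=
  if y - x == -1 then A
  else if y - x == 1 then C
  else if x == 0 then D
  else B.

Definition wstar (l : nat) (a : l.+1.-tuple int) : L :=
  \prod_(i < l) step_weight a`_i a`_i.+1.

Definition Gwstar : {fps L} :=
  Fps (fun l => \sum_(a \in @standard_walks l 0 0) wstar a).

End Weight.

(* Main.v *)
Require Import Defs.
From mathcomp Require Import all_boot all_order all_algebra.
From HB Require Import structures.
From mathcomp Require Import zify.
From mathcomp Require Import boolp classical_sets cardinality fsbigop.

Set Implicit Arguments.
Unset Strict Implicit.
Unset Printing Implicit Defensive.

Import Order.TTheory GRing.Theory Num.Theory.
Local Open Scope ring_scope.

(* Decomposing a walk at its visits to the lowest level gives
     H = 1 + z B H + z^2 C H A H,    G = 1 + z D G + z^2 C H A G,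
   where H is the case D = B of the series G; conversely these equations
   determine G, since the series of the walks from n to 0 must be (z H A)^n G.
   The entries of H and G thus solve a quadratic system
   x_j = c_j + z Q_j(x), which is shown to have an algebraic solution.
   Perturb it to y_j = c_j + z (Q_j(y) + t y_j^3), with solution in F[t][[z]].
   Modulo these equations every monomial in y is, up to a power of zt, a
   combination of monomials of bounded degree, so each y_j is algebraic over
   F(t, z). Dividing an equation of y_j by the largest possible power of t and
   setting t = 0 gives an equation of x_j. *)

(** * Congruence of power series modulo powers of [z], and fixed points *)

Section FpsCongruence.
Variable R : nzRingType.
Implicit Types (f g : {fps R}) (n : nat).

Local Notation z := (poly_fps ('X : {poly R})).

Lemma coefs_zM f n : coefs (z * f) n = if n is m.+1 then coefs f m else 0.
Proof.
rewrite coefsM big_ord_recl /= coefX mul0r add0r.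
case: n => [|n]; first by rewrite big_ord0.
rewrite big_ord_recl /= coefX mul1r subSS subn0 big1 ?addr0 // => i _.
by rewrite coefX mul0r.
Qed.

Lemma coefs_constM (c : R) f n : coefs (poly_fps c%:P * f) n = c * coefs f n.
Proof.
rewrite coefsM big_ord_recl /= coefC subn0 big1 ?addr0 // => i _.
by rewrite coefC mul0r.
Qed.

Lemma coefs_sum (I : Type) (r : seq I) (P : pred I) (f : I -> {fps R}) n :
  coefs (\sum_(i <- r | P i) f i) n = \sum_(i <- r | P i) coefs (f i) n.
Proof. by elim/big_rec2: _ => // i x y _ <-. Qed.

Definition fps_eqmod n f g := forall k, (k < n)%N -> coefs f k = coefs g k.

Lemma fps_eqmodD n f1 f2 g1 g2 : fps_eqmod n f1 f2 -> fps_eqmod n g1 g2 ->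
  fps_eqmod n (f1 + g1) (f2 + g2).
Proof. by move=> ef eg k kn; rewrite !coefsD ef ?eg. Qed.

Lemma fps_eqmodM n f1 f2 g1 g2 : fps_eqmod n f1 f2 -> fps_eqmod n g1 g2 ->
  fps_eqmod n (f1 * g1) (f2 * g2).
Proof.
move=> ef eg k kn; rewrite !coefsM; apply: eq_bigr => i _.
by rewrite ef ?eg // (leq_ltn_trans _ kn) ?leq_subr // -ltnS.
Qed.

Lemma fps_eqmod_sum n (I : Type) (r : seq I) (P : pred I) (f g : I -> {fps R}) :
    (forall i, fps_eqmod n (f i) (g i)) ->
  fps_eqmod n (\sum_(i <- r | P i) f i) (\sum_(i <- r | P i) g i).
Proof.
by move=> efg k kn; rewrite !coefs_sum; apply: eq_bigr => i _; apply: efg.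
Qed.

Lemma fps_eqmod_zM n f g : fps_eqmod n f g -> fps_eqmod n.+1 (z * f) (z * g).
Proof. by move=> efg [|k] kn; rewrite !coefs_zM ?efg. Qed.

(** [Phi] gains one degree of precision in [z], so its iterates from 0 converge coefficientwise. *)
Lemma fps_fixpoint (I : Type) (Phi : (I -> {fps R}) -> I -> {fps R}) :
    (forall n x y, (forall j, fps_eqmod n (x j) (y j)) ->
       forall j, fps_eqmod n.+1 (Phi x j) (Phi y j)) ->
  exists x, forall j, x j = Phi x j.
Proof.
move=> PhiP; pose Y n := iter n Phi (fun=> 0).
have YS n j : fps_eqmod n (Y n j) (Y n.+1 j).
  by elim: n j => [|n IH] j; [move=> k | exact: PhiP].
have Yle m n j : (n <= m)%N -> fps_eqmod n (Y n j) (Y m j).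
  move/subnK <-; elim: (m - n)%N => [|d IH] k kn //.
  by rewrite IH // addSn YS // ltn_addl.
(* The iterates from [Y n] on agree in degrees below [n], so the coefficient of [z ^ n] is first
   guaranteed at [Y n.+1]. *)
exists (fun j => Fps (fun n => coefs (Y n.+1 j) n)) => j.
apply/fpsP => n; rewrite [LHS]/=; apply: PhiP (ltnSn n) => i k kn /=.
by rewrite (Yle n k.+1).
Qed.

End FpsCongruence.

(** * Coefficientwise base change of power series *)

Section FpsMap.
Variables (R S : nzRingType) (f : {rmorphism R -> S}).

Definition fps_map (x : {fps R}) : {fps S} := Fps (fun n => f (coefs x n)).

Fact fps_map_is_zmod_morphism : zmod_morphism fps_map.
Proof. by move=> x y; apply/fpsP => n /=; rewrite rmorphB. Qed.

HB.instance Definition _ :=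
  GRing.isZmodMorphism.Build {fps R} {fps S} fps_map fps_map_is_zmod_morphism.

Fact fps_map_is_monoid_morphism : monoid_morphism fps_map.
Proof.
split=> [|x y]; apply/fpsP => n /=; first by rewrite rmorph_nat.
by rewrite rmorph_sum; apply: eq_bigr => i _; rewrite rmorphM.
Qed.

HB.instance Definition _ :=
  GRing.isMonoidMorphism.Build {fps R} {fps S} fps_map
    fps_map_is_monoid_morphism.

Lemma fps_map_poly (p : {poly R}) :
  fps_map (poly_fps p) = poly_fps (map_poly f p).
Proof. by apply/fpsP => n /=; rewrite coef_map. Qed.

End FpsMap.

(** * Finite spans over the image of [phi], and algebraicity *)

Section Span.
Variables (R E : comNzRingType) (phi : {rmorphism R -> E}).
Variables (T : finType) (m : T -> E).

Definition in_span (v : E) := exists r : T -> R, v = \sum_t phi (r t) * m t.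

Lemma in_span_gen t : in_span (m t).
Proof.
exists (fun u => (u == t)%:R); rewrite (bigD1 t) //= eqxx rmorph1 mul1r.
by rewrite big1 ?addr0 // => u /negPf ->; rewrite rmorph0 mul0r.
Qed.

Lemma in_spanZ a v : in_span v -> in_span (phi a * v).
Proof.
case=> r ->; exists (fun t => a * r t); rewrite mulr_sumr.
by apply: eq_bigr => t _; rewrite rmorphM mulrA.
Qed.

Lemma in_span_sum (I : Type) (s : seq I) (v : I -> E) :
  (forall i, in_span (v i)) -> in_span (\sum_(i <- s) v i).
Proof.
move=> vP; elim/big_ind: _ => // [|_ _ [r1 ->] [r2 ->]].
  by exists (fun=> 0); rewrite big1 // => t _; rewrite rmorph0 mul0r.
exists (fun t => r1 t + r2 t); rewrite -big_split.
by apply: eq_bigr => t _; rewrite rmorphD mulrDl.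
Qed.

End Span.

(* The vector of the [m t] is an eigenvector, for [phi c * y], of a matrix over
   [phi R]. *)
Lemma span_stable_algebraic (R : idomainType) (L : fieldType)
    (phi : {rmorphism R -> L}) (T : finType) (m : T -> L) (c : R) (y : L) t0 :
    c != 0 -> m t0 != 0 ->
    (forall t, in_span phi m (phi c * y * m t)) ->
  exists2 P : {poly R}, P != 0 & root (map_poly phi P) y.
Proof.
move=> c0 mt0 /choice[r rP].
(* Column [t] holds the coordinates of [phi c * y * m t], since [eigenvalue] refers to row
   vectors. *)
pose M := \matrix_(u < #|T|, t < #|T|) r (enum_val t) (enum_val u).
have : eigenvalue (map_mx phi M) (phi c * y).
  apply/eigenvalueP; exists (\row_u m (enum_val u)).
    apply/rowP => t; rewrite !mxE rP.
    rewrite (reindex (@enum_val T predT)) /=; last first.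
      by apply: onW_bij; exact: enum_val_bij.
    by apply: eq_bigr => u _; rewrite !mxE mulrC.
  apply: contraNneq mt0 => /rowP /(_ (enum_rank t0)).
  by rewrite !mxE enum_rankK => ->.
rewrite eigenvalue_root_char -map_char_poly => rt.
(* The characteristic polynomial vanishes at [phi c * y]; substituting [c *: 'X] moves the root to
   [y] and, as [c != 0], keeps the polynomial nonzero. *)
exists (char_poly M \Po (c *: 'X)).
  rewrite comp_poly_eq0 ?monic_neq0 ?char_poly_monic //.
  by rewrite size_scale // size_polyX.
rewrite /root map_comp_poly horner_comp linearZ /= map_polyX.
by rewrite hornerZ hornerX.
Qed.

Lemma pigeonhole_seq (T : finType) (n : nat) (w : seq T) :
  (n * #|T| < size w)%N -> exists x, (n < count_mem x w)%N.
Proof.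
move=> nw; apply/existsP; apply: contraLR nw => /existsPn cn.
rewrite -leqNgt -sum1_size (partition_big id predT) //= mulnC -sum_nat_const.
apply: leq_sum => x _; rewrite sum1_count leqNgt; exact: cn.
Qed.

Lemma perm_nseq_cat (T : eqType) (n : nat) (x : T) (w : seq T) :
  (n <= count_mem x w)%N -> exists v, perm_eq w (nseq n x ++ v).
Proof.
elim: n w => [|n IH] w nw; first by exists w.
have xw : x \in w by rewrite -has_pred1 has_count (leq_ltn_trans _ nw).
have [|v vP] := IH (rem x w).
  by rewrite count_mem_rem eqxx leq_subRL ?(leq_ltn_trans _ nw).
by exists v; rewrite (permPl (perm_to_rem xw)) perm_cons.
Qed.

(** * Monomials of bounded degree modulo cubic equations *)

Section CubicReduction.
Variables (R E : comNzRingType) (phi : {rmorphism R -> E}) (I : finType).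
Variables (y : option I -> E) (c : R).
Hypothesis y_None : y None = 1.
Hypothesis cubic : forall j, exists s : seq (R * (option I * option I)),
  phi c * y (Some j) ^+ 3 = \sum_(u <- s) phi u.1 * (y u.2.1 * y u.2.2).

Definition word_monomial (w : seq (option I)) : E := \prod_(k <- w) y k.

(* Words in the letters [option I], with [None] standing for 1, of length
   [2 * #|I|] enumerate the monomials of degree at most [2 * #|I|]. A monomial
   of degree [2 * #|I| + 1] contains a cube, which [cubic] rewrites. *)
Lemma word_monomial_span (i : option I) (w : (2 * #|I|).-tuple (option I)) :
  in_span phi (fun u : (2 * #|I|).-tuple (option I) => word_monomial u)
    (phi c * y i * word_monomial w).
Proof.
set gens := fun _ => _.
have gen (u : seq (option I)) : size u = (2 * #|I|)%N ->
    in_span phi gens (word_monomial u).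
  by move=> /eqP su; exact: (in_span_gen _ _ (Tuple su)).
rewrite -mulrA (_ : y i * _ = word_monomial (i :: w)); last first.
  by rewrite /word_monomial big_cons.
have: size (i :: w) = (2 * #|I|).+1 by rewrite /= size_tuple.
(* A letter [None] contributes 1; deleting it brings the word back to length [2 * #|I|]. *)
move: (i :: w) => {i w} w sw; have [wN|wN] := boolP (None \in w).
  rewrite /word_monomial (perm_big _ (perm_to_rem wN)) /= big_cons y_None mul1r.
  by apply/in_spanZ/gen; rewrite size_rem // sw.
have [v wE] : exists v, w = map Some v.
  elim: w wN {sw} => [|[x|] w IH] //; first by exists [::].
  by rewrite inE => /IH[v ->]; exists (x :: v).
(* Now all [2 * #|I| + 1] letters lie in [I], so one occurs at least three times. *)
have [|x cx] := @pigeonhole_seq _ 2 v; first by rewrite -(size_map Some) -wE sw.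
have [u vu] := perm_nseq_cat cx.
have {vu wE} wu : perm_eq w (map Some (nseq 3 x ++ u)) by rewrite wE perm_map.
have su : (size u).+2 = (2 * #|I|)%N.
  by apply: succn_inj; rewrite -sw (perm_size wu) size_map.
rewrite /word_monomial (perm_big _ wu) /= !big_cons.
have [s sP] := cubic x.
rewrite [X in phi c * X](_ : _ = y (Some x) ^+ 3 * word_monomial (map Some u)).
  rewrite mulrA sP mulr_suml; apply: in_span_sum => a.
  rewrite -!mulrA; apply: in_spanZ.
  (* Two letters replace the three of the cube, so the length is again [2 * #|I|]. *)
  have := gen [:: a.2.1, a.2.2 & map Some u].
  by rewrite /word_monomial !big_cons /= size_map; apply.
by rewrite /word_monomial !exprS expr0 mulr1 !mulrA.
Qed.

End CubicReduction.

(** * Specialization of an algebraic equation at [t = 0] *)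

Section Specialization.
Variable F : fieldType.

Local Notation at0 := (horner_eval (0 : F)).

(** From the outside in, the variables of [P] are the unknown, [z] and [t]. If [P] vanishes at
    [t = 0], it is divisible by [t], and the quotient still has the root [y] because power series
    over [F[t]] form a domain. The descent ends since the degree in [t] of a fixed nonzero
    coefficient drops each time. *)
Lemma root_specialize (y : {fps {poly F}}) (P : {poly {poly {poly F}}}) :
    P != 0 -> root (map_poly (@poly_fps _) P) y ->
  exists2 p : {poly {poly F}},
    p != 0 & root (map_poly (@poly_fps _) p) (fps_map at0 y).
Proof.
move=> P0 Py.
have [i Pi0] : exists i, P`_i != 0.
  by exists (size P).-1; rewrite -lead_coefE lead_coef_eq0.
have [j] : exists j, P`_i`_j != 0.
  by exists (size P`_i).-1; rewrite -lead_coefE lead_coef_eq0.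
have [n] := ubnP (size P`_i`_j); elim: n P P0 Py {Pi0}
  => // n IH P P0 Py sP Pij.
have [P00|] := eqVneq (map_poly (map_poly at0) P) 0; last first.
  exists (map_poly (map_poly at0) P) => //.
  rewrite /root -map_poly_comp (eq_map_poly (g := fps_map at0 \o @poly_fps _)).
    by rewrite map_poly_comp horner_map (eqP Py) rmorph0.
  by move=> p /=; rewrite fps_map_poly.
pose Q := map_poly (map_poly (drop_poly 1)) P.
have QE a b : Q`_a`_b = drop_poly 1 P`_a`_b.
  by rewrite coef_map_id0 ?map_poly0 // coef_map_id0 // raddf0.
have PE : P = 'X%:P%:P * Q.
  apply/polyP => a; rewrite coefCM; apply/polyP => b; rewrite coefCM QE.
  rewrite mulrC -[LHS](poly_take_drop 1) expr1; set t := take_poly _ _.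
  rewrite [t](_ : _ = 0) ?add0r //; apply/polyP => -[|d]; last first.
    by rewrite coef_take_poly coef0.
  rewrite coef_take_poly coef0 /=.
  move/(congr1 (fun p : {poly {poly F}} => p`_a`_b)): P00.
  by rewrite !coef_map /= !coef0 -horner_coef0.
have Q0 : Q != 0 by apply: contraNneq P0 => Q0; rewrite PE Q0 mulr0.
have Qij : Q`_i`_j != 0.
  by apply: contraNneq Pij => Qij; rewrite PE !coefCM Qij mulr0.
apply: (IH Q) => //.
  move: Py; rewrite PE rmorphM rootM /= map_polyC /root hornerC.
  by rewrite /= -(rmorph0 (@poly_fps {poly F})) (inj_eq (@poly_fps_inj _))
    polyC_eq0 polyX_eq0.
by move: sP; rewrite PE !coefCM mulrC size_mulX ?Qij.
Qed.

End Specialization.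

(** * Algebraic solutions of quadratic systems *)

Section QuadraticSystem.
Variables (F : fieldType) (I K : finType).
Variables (c : I -> F) (q : I -> K -> {poly F}) (l r : I -> K -> option I).

Local Notation ext x := (fun i : option I => oapp x 1 i).

(* The cubic perturbation [z * t * y_j ^ 3] makes the system zero-dimensional;
   the wanted solution is the value of [y] at [t = 0]. *)
Lemma quadratic_system_algebraic : exists x : I -> {fps F},
  (forall j, x j = poly_fps (c j)%:P + poly_fps 'X *
     \sum_k poly_fps (q j k) * (ext x (l j k) * ext x (r j k))) /\
  forall j, algebraic_over_ratfun (x j).
Proof.
(* ['X%:P] is [t], and [map_poly polyC] embeds [F[z]] into [F[t][z]]. The outer factor [z] makes the
   right-hand side contracting. *)
have [y yP] : exists y : I -> {fps {poly F}}, forall j,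
    y j = poly_fps (c j)%:P%:P + poly_fps 'X *
      (\sum_k poly_fps (map_poly polyC (q j k)) *
         (ext y (l j k) * ext y (r j k)) + poly_fps 'X%:P * y j ^+ 3).
  apply: fps_fixpoint => n x y xy j.
  have refl (f : {fps {poly F}}) m : fps_eqmod m f f by [].
  have exy i : fps_eqmod n (ext x i) (ext y i) by case: i.
  apply/fps_eqmodD/fps_eqmod_zM/fps_eqmodD => //.
    by apply: fps_eqmod_sum => k; do 2?[apply: fps_eqmodM => //].
  by rewrite !exprS; do 4?[apply: fps_eqmodM => //].
pose sp : {rmorphism {fps {poly F}} -> {fps F}} :=
  fps_map (horner_eval (0 : F)).
have spX (i : option I) : sp (ext y i) = ext (sp \o y) i.
  by case: i => //=; rewrite rmorph1.
have spC (p : {poly F}) : sp (poly_fps (map_poly polyC p)) = poly_fps p.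
  rewrite /sp /= fps_map_poly -map_poly_comp map_poly_id // => a _ /=.
  by rewrite /horner_eval hornerC.
exists (sp \o y); split=> j.
  rewrite /= {1}yP; rewrite !(rmorphD, rmorphM) /=.
  rewrite [sp (poly_fps 'X%:P)](_ : _ = 0) ?mul0r ?addr0; last first.
    by rewrite /sp /= fps_map_poly map_polyC /= /horner_eval hornerX rmorph0.
  rewrite -!(spC (c j)%:P) map_polyC /=; congr (_ + _ * _).
    by rewrite -(spC 'X) map_polyX.
  rewrite rmorph_sum; apply: eq_bigr => k _.
  by rewrite !rmorphM /= !spX spC.
pose phi : {rmorphism {poly {poly F}} -> {fraction {fps {poly F}}}} :=
  @FracField.tofrac {fps {poly F}} \o @poly_fps _.
pose yf i := FracField.tofrac (ext y i).
have ztP : 'X * 'X%:P != 0 :> {poly {poly F}}.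
  by rewrite mulf_neq0 ?polyX_eq0 ?polyC_eq0 ?polyX_eq0.
have yfN : yf None = 1 by rewrite /yf /= rmorph1.
have cubic i : exists s : seq ({poly {poly F}} * (option I * option I)),
    phi ('X * 'X%:P) * yf (Some i) ^+ 3 =
    \sum_(u <- s) phi u.1 * (yf u.2.1 * yf u.2.2).
  (* The equation of [y i] solved for [z * t * y i ^ 3]; [None] pads the linear and constant terms
     to quadratic ones. *)
  exists [:: (1, (Some i, None)), (- (c i)%:P%:P, (None, None)) &
    [seq (- ('X * map_poly polyC (q i k)), (l i k, r i k)) | k <- enum K]].
  rewrite !big_cons big_map big_enum /= yfN /yf /phi /= !mulr1.
  set S := \sum_(k in K) _; pose T :=
    \sum_k poly_fps (map_poly polyC (q i k)) * (ext y (l i k) * ext y (r i k)).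
  have -> : S = FracField.tofrac (- (poly_fps 'X * T)).
    rewrite mulr_sumr -sumrN rmorph_sum; apply: eq_bigr => k _.
    rewrite /= -!tofracM; congr FracField.tofrac.
    by rewrite rmorphN rmorphM mulNr mulrA.
  rewrite {2}yP -/T rmorph1 mul1r -!(rmorphXn, rmorphM, rmorphD) /=.
  congr FracField.tofrac; rewrite rmorphN rmorphM mulrDr addrACA subrr add0r.
  by rewrite addrAC subrr add0r mulrA.
(* This word is the monomial 1, which shows that the vector of monomials is nonzero. *)
pose one_word := [tuple (None : option I) | _ < 2 * #|I|].
have [|P P0 /eqP Py] := @span_stable_algebraic _ _ phi _ _ _ (yf (Some j))
    one_word ztP _ (word_monomial_span yfN cubic (Some j)).
  by rewrite /word_monomial big_map big1 ?oner_eq0 // => i _.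
have [|p p0 /eqP pj] := @root_specialize _ (y j) P P0.
  apply/eqP; move: Py; rewrite map_poly_comp horner_map.
  by move/eqP; rewrite tofrac_eq0 => /eqP.
exists (map_poly (@FracField.tofrac {poly F}) p).
  by rewrite map_poly_eq0_id0 // tofrac_eq0 lead_coef_eq0.
rewrite /root -map_poly_comp.
rewrite (eq_map_poly (g := @FracField.tofrac _ \o @poly_fps _)).
  by rewrite map_poly_comp horner_map pj rmorph0.
by move=> a /=; rewrite ratfun_laurent_tofrac.
Qed.

End QuadraticSystem.

(** * Recurrences for the standard walks ending at 0 *)

Section WalkSums.
Variables (L : pzRingType) (A B C D : L).

Local Notation wt := (step_weight A B C D).

(** The start [x] is left free so that deleting a first step stays within the family; [x = 0] gives
    the coefficients of [Gwstar]. *)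
Definition walk_sum (l : nat) (x : int) : L :=
  \sum_(a \in @standard_walks l x 0) wstar A B C D a.

Lemma standard_walk_cons l (x y x' : int) (a : l.+1.-tuple int) :
  standard_walks x y [tuple of x' :: a] <->
  [/\ x' = x, y <= x, a`_0 - x \in [:: -1; 0; 1] & standard_walks a`_0 y a].
Proof.
split=> [[/forallP aw /forallP ast /= <- ay]
        |[-> yx ax [/forallP aw /forallP ast _ ay]]].
  split=> //; first by have := ast ord0; rewrite /= ay.
    exact: aw ord0.
  split=> //; apply/forallP => i; first exact: aw (lift ord0 i).
  exact: ast (lift ord0 i).
split=> //; apply/forallP => -[[|i] il] //=.
- exact: (aw (Ordinal (il : (i < l)%N))).
- by rewrite ay.
exact: (ast (Ordinal (il : (i < l.+1)%N))).
Qed.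

Lemma wstar_cons l x (a : l.+1.-tuple int) :
  wstar A B C D [tuple of x :: a] = wt x a`_0 * wstar A B C D a.
Proof. by rewrite /wstar big_ord_recl. Qed.

Lemma walk_sum0 (x : int) : walk_sum 0 x = (x == 0)%:R.
Proof.
rewrite /walk_sum; have [->|x0] := eqVneq x 0.
  rewrite (_ : standard_walks 0 0 = [set [tuple 0]])%classic.
    by rewrite fsbig_set1 /wstar big_ord0.
  apply/seteqP; split=> [a [_ _ a0 _]|_ ->].
    by apply/eq_from_tnth => i; rewrite ord1 !(tnth_nth 0).
  by split=> //; apply/forallP => -[[|i] il].
rewrite (_ : standard_walks x 0 = set0)%classic ?fsbig_set0 //.
by rewrite -subset0 => a [_ _ a0 a0']; rewrite -a0 a0' eqxx in x0.
Qed.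

Lemma walk_sum_lt0 l (x : int) : x < 0 -> walk_sum l x = 0.
Proof.
move=> x0; rewrite /walk_sum (_ : standard_walks x 0 = set0)%classic.
  exact: fsbig_set0.
rewrite -subset0 => a [_ /forallP /(_ ord0) ast a0 al].
by move: ast; rewrite al a0 leNgt x0.
Qed.

(** The walks are split by their second entry [y]. As [0 <= x], prepending [x] to a standard walk
    ending at 0 keeps it standard. *)
Lemma walk_sumS l (x : int) : 0 <= x ->
  walk_sum l.+1 x = \sum_(y <- [:: x - 1; x; x + 1]) wt x y * walk_sum l y.
Proof.
move=> x0; pose W y :=
  [set [tuple of x :: a] | a in @standard_walks l y 0]%classic.
have finW y : finite_set (W y) by exact/finite_image/finite_standard_walks.
have W0 y (b : l.+2.-tuple int) : W y b -> b`_1 = y.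
  by case=> a [_ _ a0 _] <-.
have WE : standard_walks x 0 = (W (x - 1) `|` (W x `|` W (x + 1)))%classic.
  apply/seteqP; split=> [b|b].
    case/tupleP: b => x' a /standard_walk_cons[-> _ ax aw].
    suff : a`_0 \in [:: x - 1; x; x + 1].
      rewrite !inE => /or3P[] /eqP E; [left|right; left|right; right];
        by exists a; rewrite -?E.
    by move: ax; rewrite !inE !subr_eq add0r ![_ + x]addrC.
  have Wsub y : y - x \in [:: -1; 0; 1] ->
      (W y `<=` standard_walks x 0)%classic.
    move=> yx _ [a aw <-]; apply/standard_walk_cons.
    by case: (aw) => _ _ a0 _; rewrite a0.
  by case=> [|[]]; apply: Wsub; rewrite !inE ?subrr ?eqxx ?orbT //
    addrAC subrr add0r eqxx ?orbT.
have WsumE y : \sum_(b \in W y) wstar A B C D b = wt x y * walk_sum l y.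
  rewrite fsbig_image; last first.
    by move=> a b _ _ /(congr1 val) [] /val_inj.
  rewrite /walk_sum fsbig_distrr; last exact: finite_standard_walks.
  apply: eq_fsbigr => a; rewrite inE => -[_ _ a0 _].
  by rewrite wstar_cons a0.
rewrite {1}/walk_sum WE !fsbigU0 ?finite_setU //.
- by rewrite !WsumE !big_cons big_nil addr0.
- by move=> b [/W0 b1 /W0]; rewrite b1 => e; exfalso; lia.
- by move=> b [/W0 b1 [] /W0]; rewrite b1 => e; exfalso; lia.
Qed.

Lemma walk_sumSn l (n : nat) : walk_sum l.+1 n.+1%:Z =
  A * walk_sum l n%:Z + (B * walk_sum l n.+1%:Z + C * walk_sum l n.+2%:Z).
Proof.
rewrite walk_sumS // !big_cons big_nil addr0.
rewrite (_ : n.+1%:Z - 1 = n%:Z); last by lia.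
rewrite (_ : n.+1%:Z + 1 = n.+2%:Z); last by lia.
rewrite /step_weight subrr /= (_ : n%:Z - n.+1%:Z = -1); last by lia.
by rewrite (_ : n.+2%:Z - n.+1%:Z = 1); last by lia.
Qed.

Lemma walk_sumS0 l : walk_sum l.+1 0%:Z =
  D * walk_sum l 0%:Z + C * walk_sum l 1%:Z.
Proof.
by rewrite walk_sumS // !big_cons big_nil addr0 walk_sum_lt0 // mulr0 add0r.
Qed.

End WalkSums.

(** * The matrix equations for [H] and [G] *)

Section FirstPassage.
Variables (F : fieldType) (s : nat) (A B C D : 'M[F]_s).

Local Notation z := (poly_fps ('X : {poly F})).
Local Notation cst M := (map_mx (@poly_fps F \o polyC) M).

Definition coef_mx (l : nat) (M : 'M[{fps F}]_s) : 'M[F]_s :=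
  \matrix_(i, k) coefs (M i k) l.

Lemma coef_mxD l M N : coef_mx l (M + N) = coef_mx l M + coef_mx l N.
Proof. by apply/matrixP => i k; rewrite !mxE. Qed.

Lemma coef_mx1 l : coef_mx l 1%:M = (l == 0)%:R%:M.
Proof.
apply/matrixP => i k; rewrite !mxE; by case: (i == k); rewrite ?mulr1n ?mulr0n.
Qed.

Lemma coef_mx_zZ l M :
  coef_mx l (z *: M) = if l is l'.+1 then coef_mx l' M else 0.
Proof.
apply/matrixP => i k; rewrite !mxE coefs_zM.
by case: l => [|l]; rewrite !mxE.
Qed.

Lemma coef_mxMc l N M : coef_mx l (cst N *m M) = N *m coef_mx l M.
Proof.
apply/matrixP => i k; rewrite !mxE coefs_sum; apply: eq_bigr => j _.
by rewrite !mxE coefs_constM.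
Qed.

Lemma walk_system_algebraic : exists H G : 'M[{fps F}]_s,
  [/\ H = 1%:M + z *: (cst B *m H + z *: (cst C *m H *m cst A *m H)),
      G = 1%:M + z *: (cst D *m G + z *: (cst C *m H *m cst A *m G)) &
      forall i j, algebraic_over_ratfun (G i j)].
Proof.
(* The index [(b, i, k)] is the entry [(i, k)] of [H] if [b] is false, of [G] if [b] is true. *)
pose I : finType := (bool * 'I_s * 'I_s)%type.
(* [inl m] indexes the terms of [B *m H] or [D *m G]; [inr (n, m, o)] indexes the terms
   [C i o * H o m * A m n * X b n k], whose extra factor [z] is put into [q]. *)
pose K : finType := ('I_s + 'I_s * 'I_s * 'I_s)%type.
pose flat (b : bool) := if b then D else B.
pose q (j : I) (k : K) : {poly F} := match k with
  | inl m => (flat j.1.1 j.1.2 m)%:P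
  | inr k => 'X * (C j.1.2 k.2 * A k.1.2 k.1.1)%:P end.
pose l (j : I) (k : K) : option I :=
  if k is inr k then Some (false, k.2, k.1.2) else None.
pose r (j : I) (k : K) : option I := match k with
  | inl m => Some (j.1.1, m, j.2)
  | inr k => Some (j.1.1, k.1.1, j.2) end.
have [x [xE x_alg]] :=
  quadratic_system_algebraic (fun j : I => (j.1.2 == j.2)%:R) q l r.
pose X b : 'M_s := \matrix_(i, k) x (b, i, k).
have XE b : X b = 1%:M +
    z *: (cst (flat b) *m X b + z *: (cst C *m X false *m cst A *m X b)).
  apply/matrixP => i k; rewrite mxE xE /= !mxE; congr (_ + _ * _).
    by case: (i == k); rewrite ?rmorph1 ?rmorph0.
  rewrite big_sumType /=; congr (_ + _).
    by apply: eq_bigr => m _; rewrite !mxE mul1r.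
  transitivity (\sum_n \sum_m \sum_(o < s) z *
      (cst C i o * X false o m * cst A m n * X b n k)).
    rewrite !pair_bigA; apply: eq_bigr => -[[n m] o] _ /=.
    by rewrite !mxE rmorphM polyCM rmorphM /= -!mulrA; do 2!congr (_ * _);
      rewrite mulrCA.
  rewrite mulr_sumr; apply: eq_bigr => n _.
  rewrite [(_ *m cst A) i n]mxE mulr_suml mulr_sumr; apply: eq_bigr => m _.
  by rewrite [(_ *m X false) i m]mxE !mulr_suml mulr_sumr.
exists (X false), (X true); split=> [||i j]; [exact: XE|exact: XE|].
by rewrite mxE; apply: x_alg.
Qed.

Lemma Gwstar_system (H G : 'M[{fps F}]_s) :
    H = 1%:M + z *: (cst B *m H + z *: (cst C *m H *m cst A *m H)) ->
    G = 1%:M + z *: (cst D *m G + z *: (cst C *m H *m cst A *m G)) ->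
  fps_mx (Gwstar A B C D) = G.
Proof.
move=> HE GE.
(* [V n] is the generating function of the standard walks from [n] to 0: such a
   walk descends one level at a time, each level contributing [z H A]. *)
have [V [VG VHA]] : exists V : nat -> 'M[{fps F}]_s,
    V 0 = G /\ forall n, V n.+1 = z *: (H *m cst A *m V n).
  by exists (fun n => iter n (fun M => z *: (H *m cst A *m M)) G).
have V0 : V 0 = 1%:M + z *: (cst D *m V 0 + cst C *m V 1).
  by rewrite VHA VG -scalemxAr !mulmxA.
(* This is the equation of [H] multiplied on the right by [A *m V n]. *)
have VS n : V n.+1 = z *: (cst A *m V n + (cst B *m V n.+1 + cst C *m V n.+2)).
  rewrite VHA {1}HE; congr (_ *: _).
  rewrite !mulmxDl mul1mx -!scalemxAl !mulmxDl -!scalemxAl; congr (_ + _).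
  by rewrite scalerDr !VHA -!scalemxAr !mulmxA.
(* Both sides obey the same recurrence in [l], which gives all levels [n] at once from the shorter
   length. *)
have walk_sumE l n : walk_sum A B C D l n%:Z = coef_mx l (V n).
  elim: l n => [|l IH] [|n].
  - by rewrite walk_sum0 V0 coef_mxD coef_mx1 coef_mx_zZ addr0.
  - by rewrite walk_sum0 VS coef_mx_zZ.
  - rewrite walk_sumS0 V0 coef_mxD coef_mx1 coef_mx_zZ coef_mxD !coef_mxMc !IH.
    by rewrite raddf0 add0r.
  - by rewrite walk_sumSn VS coef_mx_zZ !coef_mxD !coef_mxMc !IH.
apply/matrixP => i j; apply/fpsP => l.
have /matrixP/(_ i j) := walk_sumE l 0%N.
by rewrite VG [RHS]mxE => <-; rewrite mxE.
Qed.

End FirstPassage.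

Theorem theorem2p11 (F : fieldType) (s : nat) (A B C D : 'M[F]_s) :
  forall i j : 'I_s, algebraic_over_ratfun (fps_mx (Gwstar A B C D) i j).
Proof.
have [H [G [HE GE G_alg]]] := walk_system_algebraic A B C D.
by move=> i j; rewrite (Gwstar_system HE GE).
Qed.
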